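(* There exists a 3-connected optimal 2-planar graph of even order that is not 1-extendable.
   Context: All graphs are finite, simple and undirected; the order of $G$ is $|V(G)|$. A graph is 2-planar if it can be drawn in the plane such that each edge is crossed at most twice (crossed by at most two other edges). A 2-planar graph $G$ has at most $5|V(G)|-10$ edges, and $G$ is called an optimal 2-planar graph if it is 2-planar and $|E(G)| = 5|V(G)|-10$. A graph is $k$-connected if it has more than $k$ vertices and no vertex cut of size less than $k$. For an integer $n\ge 1$, a connected graph with at least $2n+2$ vertices is $n$-extendable if it contains a perfect matching and every matching of size $n$ is a subset of a perfect matching. *)

(* Defs.v *)
From HB Require Import structures.
From mathcomp Require Import all_boot all_order all_algebra.
From mathcomp Require Import all_classical all_reals all_analysis.

Set Implicit Arguments.
Unset Strict Implicit.
Unset Printing Implicit Defensive.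

Import Order.TTheory GRing.Theory Num.Theory.
Import numFieldNormedType.Exports.

Local Open Scope classical_set_scope.
Local Open Scope ring_scope.

Record sgraph := SGraph {
  vertex :> finType;
  adj : rel vertex;
  adj_sym : symmetric adj;
  adj_irrefl : irreflexive adj }.

Definition edges (G : sgraph) : {set {set G}} :=
  [set E : {set G} |
     [exists x, exists y, adj x y && (E == [set x; y])]]%SET.

Definition connected_on (G : sgraph) (A : {set G}) : bool :=
  [forall x in A, forall y in A,
     connect [rel u v | [&& adj u v, u \in A & v \in A]] x y].

Definition connected_graph (G : sgraph) : bool :=
  connected_on [set: G]%SET.

Definition vertex_cut (G : sgraph) (S : {set G}) : bool :=
  ~~ connected_on (~: S)%SET.

Definition k_connected (k : nat) (G : sgraph) : bool :=
  (k < #|G|)%N && [forall S : {set G}, vertex_cut S ==> (k <= #|S|)%N].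

Definition matching (G : sgraph) (M : {set {set G}}) : bool :=
  (M \subset edges G) && finset.trivIset M.

Definition perfect_matching (G : sgraph) (M : {set {set G}}) : bool :=
  matching M && (finset.cover M == [set: G]%SET).

Definition extendable (n : nat) (G : sgraph) : Prop :=
  [/\ connected_graph G,
      (2 * n + 2 <= #|G|)%N,
      exists M : {set {set G}}, perfect_matching M
    & forall N : {set {set G}}, matching N -> #|N| = n ->
        exists2 M : {set {set G}}, perfect_matching M & N \subset M].

(* The values of [curve] off [edges G] are irrelevant. *)
Record drawing (R : realType) (G : sgraph) := Drawing {
  pos : G -> R * R;
  curve : {set G} -> R -> R * R;
  pos_inj : injective pos;
  curve_continuous : forall E, E \in edges G ->
    {within `[0, 1], continuous (curve E)};
  curve_inj : forall E, E \in edges G ->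
    {in `[0, 1]%R &, injective (curve E)};
  curve_ends : forall E, E \in edges G ->
    [set curve E 0; curve E 1] = pos @` [set` E];
  curve_avoids : forall E (x : G), E \in edges G ->
    ~ (curve E @` `]0, 1[) (pos x) }.

(* Every common interior point of two edges counts as a crossing. Tangencies   *)
(* are thus not excluded but counted as well, and a point shared by m edges is *)
(* m - 1 crossings on each of them. This does not affect k-planarity: as each  *)
(* edge carries finitely many such points, tangencies can be removed and       *)
(* multiple points resolved into pairwise crossings by local perturbation,     *)
(* without increasing the number of crossings on any edge.                     *)
Definition crossings (R : realType) (G : sgraph) (D : drawing R G)
    (E : {set G}) : set ({set G} * (R * R)) :=
  [set Fp | [/\ Fp.1 \in edges G, Fp.1 != E,
                (curve D E @` `]0, 1[) Fp.2
              & (curve D Fp.1 @` `]0, 1[) Fp.2]].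

Definition k_planar (R : realType) (k : nat) (G : sgraph) : Prop :=
  exists D : drawing R G,
    forall E, E \in edges G -> (crossings D E #<= `I_k)%card.

(* |E(G)| = 5|V(G)| - 10, without truncated subtraction. *)
Definition optimal_2_planar (R : realType) (G : sgraph) : Prop :=
  k_planar R 2 G /\ (#|edges G| + 10 = 5 * #|G|)%N.

(* Main.v *)
(* In an optimal 2-planar drawing the uncrossed edges bound pentagons, each     *)
(* containing all its five diagonals. Here S = {0, 1, 2, 3} spans a K4 of       *)
(* uncrossed edges, and each of its four triangular regions is filled by a copy *)
(* of a polyhedral pentagulation of the triangle with 25 inner vertices and 17  *)
(* pentagons, so that |V| = 104 and |E| = 510. Deleting S leaves four odd       *)
(* components, whereas a perfect matching through the edge 01 has only the      *)
(* vertices 2 and 3 left to reach them. Labels are chosen such that every       *)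
(* vertex v has at least min(3, v) smaller neighbours, which forces             *)
(* 3-connectedness. The vertices lie on an integer grid and edges are straight, *)
(* except for the diagonals of the outer pentagon, which have one bend. Two     *)
(* segments are shown to be disjoint by a supporting line of one of them.       *)

From Stdlib Require Import ZArith.
From HB Require Import structures.
Require Import Defs.
From mathcomp Require Import all_boot all_order all_algebra.
From mathcomp Require Import all_classical all_reals all_analysis.
From mathcomp Require Import ssrZ zify ring lra.

Set Implicit Arguments.
Unset Strict Implicit.
Unset Printing Implicit Defensive.

Delimit Scope Z_scope with stdZ.

(** * Matchings and connectivity *)

(** A perfect matching must leave each of the four odd fillings of the K4 through a corner of its
    own. Once the edge 01 is matched, only two corners remain for four fillings
    ([not_1_extendable]).

    If all faces of a plane graph are pentagons, Euler's formula gives 5(|V| - 2)/3 edges and 2(|V|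
    - 2)/3 faces, so adding the five diagonals of every face yields exactly 5|V| - 10 edges. Each
    diagonal of a pentagon crosses two others. Connectivity follows from a numbering in which every
    vertex sees enough smaller ones ([k_connected_ranking]).

    2-planarity is reduced to a finite check over the integers ([list_graph_k_planar]): edges are
    cut into stars, a separating line certifies that two stars are disjoint, and two stars on
    non-parallel lines share at most one point. Counting the pairs that are not separated therefore
    bounds the crossings. *)

Lemma edgesP (G : sgraph) (E : {set G}) :
  reflect (exists x y, adj x y /\ E = [set x; y]%SET) (E \in edges G).
Proof.
rewrite inE; apply: (iffP existsP) => [[x /existsP[y /andP[xy /eqP->]]]|].
  by exists x, y.
by case=> x [y [xy ->]]; exists x; apply/existsP; exists y; rewrite xy /=.
Qed.

(** If no matching edge left [A], then [A] would be a disjoint union of two-element edges. *)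
Lemma perfect_matching_leaves_odd (G : sgraph) (M : {set {set G}})
    (A : {set G}) :
  perfect_matching M -> odd #|A| ->
  exists x y, [/\ x \in A, y \notin A & [set x; y]%SET \in M].
Proof.
move=> /andP[/andP[/fintype.subsetP ME tI] /eqP cov] oddA.
have [/existsP[x /andP[xA /existsP[y /andP[yA xyM]]]]|noleave] :=
  boolP [exists x in A, [exists y, (y \notin A) && ([set x; y]%SET \in M)]].
  by exists x, y.
have stay x y : x \in A -> [set x; y]%SET \in M -> y \in A.
  move=> xA xyM; apply/negPn/negP => yA; case/existsP: noleave.
  by exists x; rewrite xA; apply/existsP; exists y; rewrite yA.
pose P := [set E in M | E \subset A]%SET.
have PM : P \subset M by apply/fintype.subsetP => E; rewrite inE => /andP[].
suff : odd #|A| = false by rewrite oddA.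
have -> : A = finset.cover P.
  apply/finset.setP => x; apply/idP/idP => [xA|].
    have : x \in finset.cover M by rewrite cov inE.
    case/bigcupP => E EM xE; apply/bigcupP; exists E => //.
    rewrite inE EM; have /edgesP[u [v [uv EE]]] := ME _ EM.
    move: xE EM; rewrite EE !inE => /orP[] /eqP<- EM.
      by rewrite finset.subUset !finset.sub1set xA (stay x).
    by rewrite finset.subUset !finset.sub1set xA (stay x) // finset.setUC.
  by case/bigcupP => E; rewrite inE => /andP[_ /fintype.subsetP]; apply.
have /eqP <- := trivIsetS PM tI.
rewrite (eq_bigr (fun=> 2)) => [|E]; first by rewrite sum_nat_const oddM andbF.
rewrite inE => /andP[/ME /edgesP[u [v [uv ->]]] _].
rewrite cards2; case: eqP uv => // ->; by rewrite adj_irrefl.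
Qed.

(** After deleting fewer than [k] vertices, every remaining vertex can descend through smaller
    neighbours to the remaining vertex [m] of least rank. *)
Lemma k_connected_ranking (G : sgraph) (k : nat) (r : G -> nat) :
  injective r -> k < #|G| ->
  (forall x, minn k (r x) <= #|[set y | adj y x & r y < r x]%SET|) ->
  k_connected k G.
Proof.
move=> r_inj kG down; rewrite /k_connected kG /=.
apply/forallP => S; apply/implyP; apply: contraR; rewrite -ltnNge => Sk.
apply/forallP => x0; apply/implyP => x0S.
case: (arg_minnP r x0S) => m mS m_min.
pose e := [rel u v : G | [&& adj u v, u \in (~: S)%SET & v \in (~: S)%SET]].
have e_sym : connect_sym e.
  apply: sym_connect_sym => u v /=.
  by rewrite adj_sym; congr (_ && _); exact: andbC.
have reach n : forall x, r x < n -> x \in (~: S)%SET -> connect e m x.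
  elim: n => // n IHn x xn xS.
  have [->|xm] := eqVneq x m; first exact: connect0.
  set D := [set y | adj y x & r y < r x]%SET.
  suff [y yD yS] : exists2 y, y \in D & y \in (~: S)%SET.
    move: yD; rewrite inE => /andP[yx rxy].
    apply: (connect_trans (IHn y _ yS)); first exact: leq_trans rxy _.
    by apply: connect1 => /=; rewrite yx yS.
  have [kx|xk] := leqP k (r x).
    have : ~~ (D \subset S).
      apply: contraL Sk => /subset_leq_card DS; rewrite -leqNgt.
      by apply: leq_trans DS; have := down x; rewrite (minn_idPl kx).
    by case/subsetPn => y yD yS; exists y => //; rewrite inE.
  (* At most [r x] vertices rank below [x], since [r] is injective. Hence all of them are neighbours
     of [x], and [m] is one of them. *)
  exists m => //.
  pose L := [set y | r y < r x]%SET.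
  have DL : D \subset L by apply/fintype.subsetP => y; rewrite !inE => /andP[].
  have LD : #|L| <= #|D|.
    have := down x; rewrite (minn_idPr (ltnW xk)); apply: leq_trans.
    rewrite cardE -(size_map r) -[leqRHS](size_iota 0).
    apply: uniq_leq_size; first by rewrite map_inj_uniq ?enum_uniq.
    by move=> _ /mapP[y + ->]; rewrite mem_enum inE mem_iota.
  have /eqP -> : D == L by rewrite eqEcard DL.
  rewrite inE ltn_neqAle m_min // andbT.
  by apply: contra xm => /eqP/r_inj->.
apply/forallP => y; apply/implyP => yS.
apply: (connect_trans (y := m)); last exact: reach (ltnSn _) yS.
by rewrite e_sym; exact: reach (ltnSn _) x0S.
Qed.

Lemma matching_edge_unique (G : sgraph) (M : {set {set G}}) (E F : {set G})
    (x : G) :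
  matching M -> E \in M -> F \in M -> x \in E -> x \in F -> E = F.
Proof.
move=> /andP[_ /finset.trivIsetP tI] EM FM xE xF; apply/eqP/negPn/negP => EF.
by have /pred0P/(_ x) := tI _ _ EM FM EF; rewrite /= xE xF.
Qed.

(* The easy direction of Tutte's theorem for G - u - v: a perfect matching     *)
(* through uv matches each odd C i to its own vertex of S other than u and v.  *)
Lemma not_1_extendable (G : sgraph) (I : finType) (S : {set G})
    (C : I -> {set G}) (u v : G) :
  adj u v -> u \in S -> v \in S -> #|S| < #|I| + 2 ->
  (forall i, odd #|C i|) ->
  (forall i x y, x \in C i -> adj x y -> y \notin C i -> y \in S) ->
  (forall i j x, x \in C i -> x \in C j -> i = j) ->
  (forall i x, x \in C i -> x \notin S) ->
  ~ extendable 1 G.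
Proof.
move=> uv uS vS SI oddC outC CC CS [_ _ _ ext].
have uvE : [set u; v]%SET \in edges G by apply/edgesP; exists u, v.
have uvM : matching [set [set u; v]]%SET.
  apply/andP; split; first by rewrite finset.sub1set.
  apply/finset.trivIsetP => A B; rewrite !finset.in_set1.
  by move=> /eqP -> /eqP ->; rewrite eqxx.
have [M PM] := ext _ uvM (cards1 _).
rewrite finset.sub1set => uvinM; have /andP[matM _] := PM.
pose exits i y :=
  (y \in S) && [exists x, (x \in C i) && ([set x; y]%SET \in M)].
have exitP i : exists y, exits i y.
  have [x [y [xC yC xyM]]] := perfect_matching_leaves_odd PM (oddC i).
  exists y; apply/andP; split; last by apply/existsP; exists x; rewrite xC.
  apply: (outC _ _ _ xC _ yC); have /andP[/fintype.subsetP ME _] := matM.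
  have /edgesP[a [b [ab /finset.setP xy]]] := ME _ xyM.
  have := xy x; have := xy y; rewrite !finset.in_set2 !eqxx orbT /=.
  have xNy : x != y by apply: contraNneq yC => <-.
  move=> /esym/orP[]/eqP yE /esym/orP[]/eqP xE; subst.
  - by rewrite eqxx in xNy.
  - by rewrite adj_sym.
  - by [].
  - by rewrite eqxx in xNy.
pose f i := xchoose (exitP i).
have fP i : exits i (f i) := xchooseP (exitP i).
have f_inj : injective f.
  move=> i j ij.
  have /andP[_ /existsP[x /andP[xC xM]]] := fP i.
  have /andP[fS /existsP[x' /andP[xC' xM']]] := fP j.
  rewrite ij in xM.
  have eqE : [set x; f j]%SET = [set x'; f j]%SET.
    apply: (matching_edge_unique matM xM xM' (x := f j));
      by rewrite finset.set22.
  have : x \in [set x'; f j]%SET by rewrite -eqE finset.set21.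
  rewrite finset.in_set2 => /orP[]/eqP xE; first by subst; exact: CC xC xC'.
  by have := CS _ _ xC; rewrite xE fS.
(* A vertex of [C i] matched to [u] or [v] would be an end of the edge [uv], hence in [S]. *)
have f_uv i : f i \notin [set u; v]%SET.
  apply/negP => fuv.
  have /andP[_ /existsP[x /andP[xC xM]]] := fP i.
  have eqE := matching_edge_unique matM xM uvinM (finset.set22 _ _) fuv.
  have : x \in [set u; v]%SET by rewrite -eqE finset.set21.
  have := CS _ _ xC.
  by rewrite finset.in_set2 => xS /orP[]/eqP xE; rewrite xE ?uS ?vS in xS.
have : #|f @: [set: I]|%SET <= #|S :\: [set u; v]|%SET.
  apply/subset_leq_card/fintype.subsetP => _ /imsetP[i _ ->].
  by rewrite finset.in_setD f_uv; have /andP[] := fP i.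
rewrite card_imset // cardsT => IS.
have uvS : [set u; v]%SET \subset S.
  by apply/fintype.subsetP => x; rewrite finset.in_set2 => /orP[]/eqP->.
have uNv : u != v by apply: contraTneq uv => ->; rewrite adj_irrefl.
move: SI; rewrite -(cardsID [set u; v]%SET S) (finset.setIidPr uvS) cards2 uNv.
by rewrite addnC ltn_add2r ltnNge IS.
Qed.

(** * Stars and supporting lines *)

Definition point : Type := (Z * Z)%type.

Definition affine : Type := (Z * Z * Z)%type.

Definition aff (l : affine) (p : point) : Z :=
  (l.1.1 * p.1 + l.1.2 * p.2 + l.2)%stdZ.

Definition affN (l : affine) : affine := (- l.1.1, - l.1.2, - l.2)%stdZ.

Definition line (a b : point) : affine :=
  (a.2 - b.2, b.1 - a.1, a.1 * b.2 - b.1 * a.2)%stdZ.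

(* The union of the half-open segments ]p, hub] over the feet p. The open edge *)
(* curves are unions of such stars: one with two feet for a straight edge, two *)
(* with a single foot for an edge with a bend. Every point of a star puts a    *)
(* positive weight on the hub, which is why strictness is required only there. *)
Record star := Star {
  star_edge : nat * nat;
  feet : seq point;
  hub : point;
  carrier : affine;
  sides : seq affine }.

HB.instance Definition _ := gen_eqMixin star.

Definition nonpos (l : affine) (c : star) : bool :=
  all (fun p => (aff l p <=? 0)%stdZ) (hub c :: feet c).

Definition supported (c : star) : bool := all (fun l => nonpos l c) (sides c).

Definition carried (c : star) : bool :=
  all (fun p => (aff (carrier c) p =? 0)%stdZ) (hub c :: feet c).

Definition beyond (l : affine) (c : star) : bool :=
  (0 <? aff l (hub c))%stdZ && all (fun p => (0 <=? aff l p)%stdZ) (feet c).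

(** Contact at feet is tolerated, so edges with a common end can be separated by a line through
    it. *)
Definition separated (c d : star) : bool :=
  has (fun l => beyond l d) (sides c) || has (fun l => beyond l c) (sides d).

Definition transversal (c d : star) : bool :=
  ~~ ((carrier c).1.1 * (carrier d).1.2 =?
      (carrier c).1.2 * (carrier d).1.1)%stdZ.

(** * Stars and bent paths in the real plane *)

Import Order.TTheory GRing.Theory Num.Theory.
Import numFieldNormedType.Exports.
Local Open Scope classical_set_scope.
Local Open Scope ring_scope.

Definition zR (R : realType) (z : Z) : R := (int_of_Z z)%:~R.

Lemma zRD (R : realType) (a b : Z) : zR R (a + b)%stdZ = zR R a + zR R b.
Proof. by rewrite /zR -rmorphD -(rmorphD int_of_Z). Qed.

Lemma zRM (R : realType) (a b : Z) : zR R (a * b)%stdZ = zR R a * zR R b.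
Proof. by rewrite /zR -rmorphM -(rmorphM int_of_Z). Qed.

Lemma zRN (R : realType) (a : Z) : zR R (- a)%stdZ = - zR R a.
Proof. by rewrite /zR -rmorphN -(rmorphN int_of_Z). Qed.

Lemma zR_inj (R : realType) : injective (zR R).
Proof. by move=> a b /intr_inj /(can_inj int_of_ZK). Qed.

Lemma zR_gt0 (R : realType) (z : Z) : (0 <? z)%stdZ -> 0 < zR R z.
Proof.
case: z => // p _; rewrite /zR /= ltr0n.
apply/ssrnat.ltP; exact: Pnat.Pos2Nat.is_pos.
Qed.

Lemma zR_ge0 (R : realType) (z : Z) : (0 <=? z)%stdZ -> 0 <= zR R z.
Proof. by case: z => //= p _; rewrite /zR /= ler0n. Qed.

Lemma zR_le0 (R : realType) (z : Z) : (z <=? 0)%stdZ -> zR R z <= 0.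
Proof. by case: z => //= p _; rewrite -oppr_ge0 -zRN zR_ge0. Qed.

Lemma zR_lt (R : realType) (a b : Z) : (a <? b)%stdZ -> zR R a < zR R b.
Proof.
move=> /Z.ltb_lt/Z.lt_0_sub ab; rewrite -subr_gt0 -zRN -zRD; apply: zR_gt0.
exact/Z.ltb_lt.
Qed.

Definition ptR (R : realType) (p : point) : R * R := (zR R p.1, zR R p.2).

Definition affR (R : realType) (l : affine) (q : R * R) : R :=
  zR R l.1.1 * q.1 + zR R l.1.2 * q.2 + zR R l.2.

Lemma affR_ptR (R : realType) (l : affine) (p : point) :
  affR l (ptR R p) = zR R (aff l p).
Proof. by rewrite /affR /aff !zRD !zRM. Qed.

Definition conv2 (R : realType) (s : R) (a b : R * R) : R * R :=
  (a.1 + s * (b.1 - a.1), a.2 + s * (b.2 - a.2)).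

Lemma affR_conv2 (R : realType) (l : affine) (s : R) (a b : R * R) :
  affR l (conv2 s a b) = (1 - s) * affR l a + s * affR l b.
Proof. by rewrite /affR /conv2 /=; ring. Qed.

Definition star_set (R : realType) (c : star) : set (R * R) :=
  [set q | exists2 p, p \in feet c &
     exists2 s, 0 < s <= 1 & q = conv2 s (ptR R p) (ptR R (hub c))].

Lemma beyond_gt0 (R : realType) (l : affine) (c : star) (q : R * R) :
  beyond l c -> star_set c q -> 0 < affR l q.
Proof.
move=> /andP[hub_gt0 /allP feet_ge0] [p pc [s /andP[s0 s1] ->]].
rewrite affR_conv2 ltr_wpDl//.
  by rewrite mulr_ge0 ?subr_ge0// affR_ptR zR_ge0// feet_ge0.
by rewrite mulr_gt0// affR_ptR zR_gt0.
Qed.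

Lemma nonpos_le0 (R : realType) (l : affine) (c : star) (q : R * R) :
  nonpos l c -> star_set c q -> affR l q <= 0.
Proof.
move=> /andP[hub_le0 /allP feet_le0] [p pc [s /andP[s0 s1] ->]].
rewrite affR_conv2 -oppr_ge0 opprD -!mulrN addr_ge0//.
  by rewrite mulr_ge0 ?subr_ge0// oppr_ge0 affR_ptR zR_le0// feet_le0.
by rewrite mulr_ge0 ?(ltW s0)// oppr_ge0 affR_ptR zR_le0.
Qed.

Lemma separated_disjoint (R : realType) (c d : star) (q : R * R) :
  supported c -> supported d -> separated c d ->
  star_set c q -> ~ star_set d q.
Proof.
move=> /allP cS /allP dS /orP[] /hasP[l lS lb] cq dq.
  by have := nonpos_le0 (cS _ lS) cq; rewrite leNgt (beyond_gt0 lb dq).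
by have := nonpos_le0 (dS _ lS) dq; rewrite leNgt (beyond_gt0 lb cq).
Qed.

Lemma carried_eq0 (R : realType) (c : star) (q : R * R) :
  carried c -> star_set c q -> affR (carrier c) q = 0.
Proof.
move=> /andP[/Z.eqb_eq hub0 /allP feet0] [p pc [s _ ->]].
have /Z.eqb_eq p0 := feet0 p pc.
by rewrite affR_conv2 !affR_ptR hub0 p0 !mulr0 addr0.
Qed.

(** Cramer's rule: both points solve the same linear system with nonzero determinant. *)
Lemma transversal_unique (R : realType) (c d : star) (q q' : R * R) :
  carried c -> carried d -> transversal c d ->
  star_set c q -> star_set d q -> star_set c q' -> star_set d q' -> q = q'.
Proof.
move=> cc cd ncd /(carried_eq0 cc) cq /(carried_eq0 cd) dq
  /(carried_eq0 cc) cq' /(carried_eq0 cd) dq'.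
move: ncd cq dq cq' dq'; rewrite /transversal.
move: (carrier c) (carrier d) => -[[a b] e] [[a' b'] e'] /=.
rewrite /affR; case: q q' => [x y] [x' y'] /=.
move=> /negbTE/Z.eqb_neq det; have : zR R a * zR R b' - zR R b * zR R a' != 0.
  by rewrite -!zRM subr_eq0; apply/eqP => /zR_inj.
move: (zR R a) (zR R b) (zR R e) (zR R a') (zR R b') (zR R e').
move=> A B E A' B' E' D h1 h2 h3 h4.
have Hx : (A * B' - B * A') * (x - x') = 0.
  have -> : (A * B' - B * A') * (x - x') =
    B' * ((A * x + B * y + E) - (A * x' + B * y' + E))
    - B * ((A' * x + B' * y + E') - (A' * x' + B' * y' + E')) by ring.
  by rewrite h1 h2 h3 h4 !subrr !mulr0 subrr.
have Hy : (A * B' - B * A') * (y - y') = 0.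
  have -> : (A * B' - B * A') * (y - y') =
    A * ((A' * x + B' * y + E') - (A' * x' + B' * y' + E'))
    - A' * ((A * x + B * y + E) - (A * x' + B * y' + E)) by ring.
  by rewrite h1 h2 h3 h4 !subrr !mulr0 subrr.
move/eqP: Hx; move/eqP: Hy.
by rewrite !mulf_eq0 (negbTE D) /= !subr_eq0 => /eqP-> /eqP->.
Qed.

(* The absolute values make this the polygonal path a, m, b: up to t = 1/2 the *)
(* weight of b - m vanishes, from then on that of m - a is 1.                  *)
Definition bent_path (R : realType) (a m b : R * R) (t : R) : R * R :=
  let u := t + 2^-1 - `|t - 2^-1| in let v := t - 2^-1 + `|t - 2^-1| in
  (a.1 + u * (m.1 - a.1) + v * (b.1 - m.1),
   a.2 + u * (m.2 - a.2) + v * (b.2 - m.2)).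

Lemma bent_path_continuous (R : realType) (a m b : R * R) :
  continuous (bent_path a m b).
Proof.
move=> t; rewrite /bent_path.
have cabs : {for t, continuous (fun t : R => `|t - 2^-1|)}.
  apply: (@continuous_comp _ _ _ (fun t : R => t - 2^-1) (fun u : R => `|u|)).
    by apply: cvgB; [exact: cvg_id|exact: cvg_cst].
  exact: norm_continuous.
have coord p q r : {for t, continuous (fun t : R =>
    p + (t + 2^-1 - `|t - 2^-1|) * q + (t - 2^-1 + `|t - 2^-1|) * r)}.
  apply: cvgD; [apply: cvgD; first exact: cvg_cst|];
    apply: cvgM; try exact: cvg_cst.
    by apply: cvgB; [apply: cvgD; [exact: cvg_id|exact: cvg_cst]|exact: cabs].
  by apply: cvgD; [apply: cvgB; [exact: cvg_id|exact: cvg_cst]|exact: cabs].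
exact: (cvg_pair (coord _ _ _) (coord _ _ _)).
Qed.

Lemma bent_path_fst (R : realType) (a m b : R * R) (t : R) :
  t <= 2^-1 -> bent_path a m b t = conv2 (2 * t) a m.
Proof.
move=> t2; rewrite /bent_path ler0_norm ?subr_le0// /conv2.
by congr (_, _); field.
Qed.

Lemma bent_path_snd (R : realType) (a m b : R * R) (t : R) :
  2^-1 <= t -> bent_path a m b t = conv2 (2 * (1 - t)) b m.
Proof.
move=> t2; rewrite /bent_path ger0_norm ?subr_ge0// /conv2.
by congr (_, _); field.
Qed.

Lemma bent_path0 (R : realType) (a m b : R * R) : bent_path a m b 0 = a.
Proof.
rewrite bent_path_fst ?invr_ge0 ?ler0n// /conv2.
by rewrite !mulr0 !mul0r !addr0 -surjective_pairing.
Qed.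

Lemma bent_path1 (R : realType) (a m b : R * R) : bent_path a m b 1 = b.
Proof.
rewrite bent_path_snd ?invf_le1 ?ltr0n ?ler1n// /conv2.
by rewrite subrr !mulr0 !mul0r !addr0 -surjective_pairing.
Qed.

(** The functional [l] increases strictly along both pieces, hence along the whole path. *)
Lemma bent_path_inj (R : realType) (l : affine) (a m b : R * R) :
  affR l a < affR l m -> affR l m < affR l b -> injective (bent_path a m b).
Proof.
move=> am mb.
have mono : {mono (affR l \o bent_path a m b) : x y / x <= y}.
  apply: le_mono => x y xy /=.
  have [y2|/ltW y2] := leP y 2^-1.
    by rewrite !bent_path_fst ?(le_trans (ltW xy))// !affR_conv2; nra.
  have [x2|/ltW x2] := leP x 2^-1; last first.
    by rewrite !bent_path_snd// !affR_conv2; nra.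
  rewrite bent_path_fst// bent_path_snd// !affR_conv2.
  have [x2'|x2'] := eqVneq x 2^-1; first by subst x; nra.
  have : x < 2^-1 by rewrite lt_neqAle x2'.
  by nra.
by move=> x y xy; apply: (inc_inj mono); rewrite /= xy.
Qed.

(** * Graphs given by edge lists and their polygonal drawings *)

Definition sort2 (x y : nat) : nat * nat := (minn x y, maxn x y).

Section ListGraph.
Variables (n : nat) (E : seq (nat * nat)).

Definition list_adj (x y : 'I_n.+1) : bool := (x != y) && (sort2 x y \in E).

Lemma list_adj_sym : symmetric list_adj.
Proof. by move=> x y; rewrite /list_adj /sort2 minnC maxnC eq_sym. Qed.

Lemma list_adj_irrefl : irreflexive list_adj.
Proof. by move=> x; rewrite /list_adj eqxx. Qed.

Definition list_graph : sgraph := SGraph list_adj_sym list_adj_irrefl.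

Definition list_edge (e : nat * nat) : {set list_graph} :=
  [set inord e.1; inord e.2]%SET.

Definition bounded : bool :=
  all (fun e => (e.1 < e.2)%N && (e.2 < n.+1)%N) E.

End ListGraph.

Section Polygonal.
Variables (n : nat) (E : seq (nat * nat)).
Variables (P : nat -> point) (bends : seq ((nat * nat) * point)).

(** For an edge without a bend [index] overruns the list and [nth] returns the midpoint, through
    which [bent_path] is a straight segment. *)
Definition mid (e : nat * nat) : point :=
  let p := P e.1 in let q := P e.2 in
  nth (Z.div2 (p.1 + q.1), Z.div2 (p.2 + q.2))%stdZ
    (map snd bends) (index e (map fst bends)).

(** The candidates are the sides of the bounding box and the carrier line with both signs; the
    filter makes the star supported by construction. Of two disjoint segments on distinct lines, one
    lies on one side of the line of the other; boxes settle the collinear case. *)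
Definition mk_star (e : nat * nat) (s : seq point) : star :=
  let m := mid e in let l := line m (head m s) in
  let xs := map fst s in let ys := map snd s in
  let candidates :=
    [:: (1, 0, - foldr Z.max m.1 xs)%stdZ; (-1, 0, foldr Z.min m.1 xs)%stdZ;
        (0, 1, - foldr Z.max m.2 ys)%stdZ; (0, -1, foldr Z.min m.2 ys)%stdZ;
        l; affN l] in
  Star e s m l [seq h <- candidates | nonpos h (Star e s m l [::])].

Definition stars (e : nat * nat) : seq star :=
  if e \in map fst bends then [:: mk_star e [:: P e.1]; mk_star e [:: P e.2]]
  else [:: mk_star e [:: P e.1; P e.2]].

Definition meeting (T : seq star) (c : star) : seq (star * star) :=
  [seq (c, d) | d <- T & ~~ separated c d && (star_edge d != star_edge c)].

(** Every pair that is not separated is counted, whether or not the two stars meet. *)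
Definition crossing_check (k : nat) : bool :=
  let T := map stars E in
  let U := flatten T in
  all (fun s => let L := flatten (map (meeting U) s) in
         (size L <= k)%N && all (fun cd => transversal cd.1 cd.2) L) T.

Definition avoid_check : bool :=
  let V := [seq (v, P v) | v <- iota 0 n.+1] in
  all (fun c =>
         all (fun vp => has (fun l => (0 <? aff l vp.2)%stdZ) (sides c)
             || (vp.1 \in [:: (star_edge c).1; (star_edge c).2])) V)
    (flatten (map stars E)).

(** Here [l] is the scalar product with [b - a], the functional fed to [bent_path_inj]. *)
Definition monotone_check : bool :=
  all (fun e => let a := P e.1 in let b := P e.2 in
         let l := (b.1 - a.1, b.2 - a.2, 0)%stdZ in
         (aff l a <? aff l (mid e))%stdZ && (aff l (mid e) <? aff l b)%stdZ) E.

Definition carried_check : bool := all carried (flatten (map stars E)).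

End Polygonal.

Section ListGraphTheory.
Variables (n : nat) (E : seq (nat * nat)).
Hypotheses (E_bounded : bounded n E).
Local Notation G := (list_graph n E).

Lemma list_edge_bound e : e \in E -> ((e.1 < e.2) && (e.2 < n.+1))%N.
Proof. exact: (allP E_bounded). Qed.

Lemma list_edge_val e : e \in E ->
  ((inord e.1 : 'I_n.+1) = e.1 :> nat) /\ ((inord e.2 : 'I_n.+1) = e.2 :> nat).
Proof.
move=> /list_edge_bound/andP[e12 e2].
by rewrite !inordK// (ltn_trans e12).
Qed.

Lemma list_adj_lt (x y : G) :
  (x < y)%N -> adj x y = ((x : nat, y : nat) \in E).
Proof.
move=> xy; rewrite [adj _ _]/(list_adj E x y) /list_adj /sort2.
by rewrite (minn_idPl (ltnW xy)) (maxn_idPr (ltnW xy)) -val_eqE /= ltn_eqF.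
Qed.

Lemma list_edge_adj e : e \in E -> adj (inord e.1 : G) (inord e.2).
Proof.
move=> ee; have [e1 e2] := list_edge_val ee.
have /andP[e12 _] := list_edge_bound ee.
by rewrite list_adj_lt e1 e2 // -surjective_pairing.
Qed.

Lemma list_edgesP (F : {set G}) :
  reflect (exists2 e, e \in E & F = list_edge n E e) (F \in edges G).
Proof.
apply: (iffP (edgesP _)) => [[x [y [xy ->]]]|[e ee ->]]; last first.
  by exists (inord e.1), (inord e.2); split=> //; exact: list_edge_adj.
wlog lt_xy : x y xy / (x < y)%N => [th|].
  have [|yx|/ord_inj eq_xy] := ltngtP x y; first exact: th.
    by rewrite finset.setUC; apply: th => //; rewrite adj_sym.
  by rewrite eq_xy adj_irrefl in xy.
exists (x : nat, y : nat); first by rewrite -list_adj_lt.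
by rewrite /list_edge !inord_val.
Qed.

Lemma list_edge_inj : {in E &, injective (list_edge n E)}.
Proof.
move=> e f ee ff ef; have [e1 e2] := list_edge_val ee.
have [f1 f2] := list_edge_val ff.
have /andP[e12 _] := list_edge_bound ee.
have /andP[f12 _] := list_edge_bound ff.
have endpoint (x : 'I_n.+1) :
    x \in list_edge n E e -> (x : nat) = f.1 \/ (x : nat) = f.2.
  by rewrite ef !inE => /orP[]/eqP->; rewrite ?f1 ?f2; [left|right].
have := endpoint (inord e.1); have := endpoint (inord e.2).
rewrite !inE !eqxx orbT e1 e2 => /(_ isT) h2 /(_ isT) h1.
rewrite (surjective_pairing e) (surjective_pairing f).
by congr (_, _); lia.
Qed.

Lemma card_list_edges : uniq E -> #|edges G| = size E.
Proof.
move=> uE; have u : uniq (map (list_edge n E) E).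
  by rewrite map_inj_in_uniq //; exact: list_edge_inj.
rewrite -(size_map (list_edge n E)) -(card_uniqP u); apply: eq_card => F.
by apply/list_edgesP/mapP => -[e ee ->]; exists e.
Qed.

(** Edges are listed with the smaller end first, so an entry ending in [x] starts at a smaller
    neighbour. *)
Lemma list_graph_lower_neighbours (x : G) : uniq E ->
  (count (fun e => e.2 == x :> nat) E
     <= #|[set y : G | adj y x & y < x]%SET|)%N.
Proof.
move=> uE; rewrite -size_filter.
rewrite -(size_map (fun e => inord e.1 : 'I_n.+1)) cardE.
apply: uniq_leq_size.
  rewrite map_inj_in_uniq ?filter_uniq // => e f.
  rewrite !mem_filter => /andP[/eqP e2 ee] /andP[/eqP f2 ff] /(congr1 val) /=.
  rewrite (list_edge_val ee).1 (list_edge_val ff).1 => ef.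
  by rewrite (surjective_pairing e) (surjective_pairing f) ef e2 f2.
move=> _ /mapP[e + ->]; rewrite mem_filter => /andP[/eqP e2 ee].
have /andP[e12 _] := list_edge_bound ee.
have e1 := (list_edge_val ee).1.
rewrite mem_enum inE e1 -e2 e12 andbT list_adj_lt e1 -e2 //.
by rewrite -surjective_pairing.
Qed.

Lemma list_graph_k_connected (k : nat) : uniq E -> (k < n.+1)%N ->
  all (fun v => minn k v <= count (fun e => e.2 == v) E)%N (iota 0 n.+1) ->
  k_connected k G.
Proof.
move=> uE kn /allP down; apply: (@k_connected_ranking G k (@nat_of_ord n.+1)).
- exact: ord_inj.
- by rewrite card_ord.
move=> x; apply: leq_trans (list_graph_lower_neighbours x uE).
by apply: down; rewrite mem_iota ltn_ord.
Qed.

End ListGraphTheory.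

Section PolygonalTheory.
Variables (R : realType) (n : nat) (E : seq (nat * nat)).
Variables (P : nat -> point) (bends : seq ((nat * nat) * point)).
Hypotheses (E_bounded : bounded n E) (P_uniq : uniq (map P (iota 0 n.+1))).
Hypotheses (E_monotone : monotone_check E P bends)
  (E_avoid : avoid_check n E P bends).
Local Notation G := (list_graph n E).
Local Notation stars := (stars P bends).
Local Notation mid := (mid P bends).

Let pos (x : G) : R * R := ptR R (P (x : 'I_n.+1)).

Let path (e : nat * nat) : R -> R * R :=
  bent_path (ptR R (P e.1)) (ptR R (mid e)) (ptR R (P e.2)).

(** Drawings index curves by vertex sets, paths are indexed by number pairs; this inverts
    [list_edge] on [E]. *)
Let code (F : {set G}) : nat * nat :=
  head (0, 0)%N [seq e <- E | list_edge n E e == F].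

Lemma code_edge e : e \in E -> code (list_edge n E e) = e.
Proof.
move=> ee; rewrite /code; set s := [seq _ <- _ | _].
have : e \in s by rewrite mem_filter eqxx.
have : {subset s <= [pred f in E | list_edge n E f == list_edge n E e]}.
  by move=> f; rewrite mem_filter inE /= andbC.
case: s => [//|f s] /(_ f (mem_head _ _)) /andP[ff /eqP fe] _ /=.
exact: list_edge_inj fe.
Qed.

Lemma pos_injective : injective pos.
Proof.
move=> x y [/zR_inj h1 /zR_inj h2]; apply: ord_inj.
have := P_uniq; move=> /(uniqP (P 0%N)).
rewrite size_map size_iota => /(_ x y); rewrite !inE !ltn_ord.
move=> /(_ isT isT); apply.
rewrite !(nth_map 0%N) ?size_iota ?ltn_ord// !nth_iota ?ltn_ord// !add0n.
by rewrite (surjective_pairing (P x)) (surjective_pairing (P y)) h1 h2.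
Qed.

Lemma path_injective e : e \in E -> injective (path e).
Proof.
move=> /(allP E_monotone) /= /andP[].
set l := (_, _, _) => am mb.
by apply: (@bent_path_inj _ l); rewrite !affR_ptR; exact: zR_lt.
Qed.

Lemma starsP e c :
  c \in stars e -> exists s, c = mk_star P bends e s.
Proof.
rewrite /stars; case: ifP => _; rewrite !inE.
  by case/orP=> /eqP ->; [exists [:: P e.1]|exists [:: P e.2]].
by move=> ->; exists [:: P e.1; P e.2].
Qed.

Lemma stars_edge e c : c \in stars e -> star_edge c = e.
Proof. by move=> /starsP[s ->]. Qed.

Lemma stars_supported e c : c \in stars e -> supported c.
Proof.
by move=> /starsP[s ->]; apply/allP => l; rewrite mem_filter => /andP[].
Qed.

Lemma path_stars e q : (path e @` `]0, 1[) q ->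
  exists2 c, c \in stars e & star_set c q.
Proof.
case=> t /=; rewrite in_itv /= => /andP[t0 t1] <-.
have [p pe [s s01 ->]] : exists2 p, p \in [:: P e.1; P e.2] &
    exists2 s, 0 < s <= 1 & path e t = conv2 s (ptR R p) (ptR R (mid e)).
  have [t2|/ltW t2] := leP t 2^-1.
    exists (P e.1); first by rewrite mem_head.
    exists (2 * t); last by rewrite /path bent_path_fst.
    by apply/andP; split; lra.
  exists (P e.2); first by rewrite !inE eqxx orbT.
  exists (2 * (1 - t)); last by rewrite /path bent_path_snd.
  by apply/andP; split; lra.
rewrite /stars; case: ifP => _.
  exists (mk_star P bends e [:: p]).
    by move: pe; rewrite !inE => /orP[]/eqP->; rewrite eqxx ?orbT.
  by exists p; [rewrite mem_head|exists s].
exists (mk_star P bends e [:: P e.1; P e.2]); first by rewrite mem_head.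
by exists p => //; exists s.
Qed.

Lemma path_avoids e (x : G) : e \in E -> ~ (path e @` `]0, 1[) (pos x).
Proof.
move=> ee xe; have [c ce cx] := path_stars xe.
have c_in : c \in flatten (map stars E) by apply/flatten_mapP; exists e.
have x_in : ((x : 'I_n.+1) : nat, P x) \in [seq (v, P v) | v <- iota 0 n.+1].
  by apply: map_f; rewrite mem_iota ltn_ord.
have := allP (allP E_avoid _ c_in) _ x_in.
rewrite (stars_edge ce) /= => /orP[/hasP[l lc lx]|].
  have := nonpos_le0 (allP (stars_supported ce) _ lc) cx.
  by rewrite leNgt affR_ptR zR_gt0.
(* The ends of [e] are exempt from the line test: they are the values of the path at 0 and 1, so
   injectivity excludes them. *)
case: xe => t; rewrite /= in_itv /= => /andP[t0 t1] tx.
rewrite !inE => /orP[]/eqP xe.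
  have : path e t = path e 0 by rewrite tx /path bent_path0 /pos xe.
  by move/(path_injective ee) => t00; rewrite t00 ltxx in t0.
have : path e t = path e 1 by rewrite tx /path bent_path1 /pos xe.
by move/(path_injective ee) => t11; rewrite t11 ltxx in t1.
Qed.

Lemma path_ends e : e \in E ->
  [set path e 0; path e 1] = pos @` [set` list_edge n E e].
Proof.
move=> ee; have [e1 e2] := list_edge_val E_bounded ee.
rewrite /path bent_path0 bent_path1; apply/seteqP; split => q /=.
  case=> ->; [exists (inord e.1)|exists (inord e.2)];
    by rewrite ?inE ?eqxx ?orbT // /pos ?e1 ?e2.
case=> x + <-; rewrite !inE => /orP[]/eqP->; rewrite /pos ?e1 ?e2.
  by left.
by right.
Qed.

Lemma polygonal_drawing : exists D : drawing R G,
  forall e, e \in E -> curve D (list_edge n E e) = path e.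
Proof.
have cP F : F \in edges G -> code F \in E /\ F = list_edge n E (code F).
  by move=> /(list_edgesP E_bounded)[e ee ->]; rewrite code_edge.
unshelve refine
  (ex_intro _ (@Drawing R G pos (fun F => path (code F)) _ _ _ _ _) _).
- exact: pos_injective.
- by move=> F _; apply: continuous_subspaceT; exact: bent_path_continuous.
- by move=> F /cP[ce _] x y _ _; exact: path_injective.
- by move=> F /cP[ce FE]; rewrite [in RHS]FE; exact: path_ends.
- by move=> F x /cP[ce _]; exact: path_avoids.
- by move=> e ee /=; rewrite code_edge.
Qed.

Lemma list_graph_k_planar (k : nat) : carried_check E P bends ->
  crossing_check E P bends k -> k_planar R k G.
Proof.
move=> /allP E_carried /allP E_cross.
have [D DE] := polygonal_drawing; exists D.
move=> F /(list_edgesP E_bounded)[e ee ->].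
have /E_cross /= := map_f stars ee.
set L := flatten _ => /andP[Lk /allP Ltr].
(* A listed pair of stars determines its crossing: the edge of the second star and the only common
   point, chosen by [xget]. *)
pose g (cd : star * star) : {set G} * (R * R) :=
  (list_edge n E (star_edge cd.2),
   xget (0, 0) (star_set cd.1 `&` star_set cd.2)).
have sub : crossings D (list_edge n E e) `<=`
    (nth (finset.set0, (0, 0)) (map g L)) @` `I_k.
  move=> [F' q] [/= /(list_edgesP E_bounded)[f fE ->]] fe.
  rewrite DE// DE// => /path_stars[c ce cq] /path_stars[d df dq].
  have cT : c \in flatten (map stars E) by apply/flatten_mapP; exists e.
  have dT : d \in flatten (map stars E) by apply/flatten_mapP; exists f.
  have cdL : (c, d) \in L.
    apply/flatten_mapP; exists c => //; apply: map_f.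
    rewrite mem_filter dT andbT (stars_edge ce) (stars_edge df).
    apply/andP; split; last by apply: contra fe => /eqP->.
    apply/negP => sep.
    exact: (separated_disjoint (stars_supported ce) (stars_supported df)
      sep cq dq).
  have gE : g (c, d) = (list_edge n E f, q).
    rewrite /g /= (stars_edge df); congr (_, _).
    apply: xget_unique => // q' [cq' dq'].
    exact: (transversal_unique (E_carried _ cT) (E_carried _ dT) (Ltr _ cdL)).
  exists (index (c, d) L) => /=.
    by rewrite (leq_trans _ Lk)// index_mem.
  by rewrite (nth_map (c, d)) ?index_mem// nth_index.
exact: card_le_trans (subset_card_le sub) (card_image_le _ _).
Qed.

End PolygonalTheory.

(** * The graph *)

Local Open Scope nat_scope.

(* The vertices 0, 1, 2 are the corners of the filled triangle. *)
Definition pentagons : seq (seq nat) :=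
  [::
     [:: 16; 20; 17; 15; 12]; [:: 23; 24; 19; 18; 17]; [:: 6; 5; 3; 7; 8];
     [:: 0; 11; 16; 12; 10]; [:: 13; 9; 10; 12; 15]; [:: 14; 18; 19; 8; 7];
     [:: 2; 1; 3; 5; 4]; [:: 16; 11; 21; 22; 20]; [:: 0; 2; 4; 21; 11];
     [:: 22; 21; 4; 25; 26]; [:: 14; 7; 3; 9; 13]; [:: 14; 13; 15; 17; 18];
     [:: 23; 26; 25; 27; 24]; [:: 23; 17; 20; 22; 26]; [:: 0; 10; 9; 3; 1];
     [:: 6; 8; 19; 24; 27]; [:: 6; 27; 25; 4; 5]].

Definition coords : seq (Z * Z) :=
  [::
     (45, 79); (4, 23); (59, 4); (36, 35); (4, 81); (94, 52); (59, 100);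
     (59, 98); (24, 87); (53, 96); (21, 82); (42, 81); (65, 69); (48, 82);
     (34, 85); (36, 88); (47, 85); (58, 76); (54, 87); (50, 91); (54, 93);
     (61, 78); (81, 60); (73, 69); (66, 80); (63, 86); (84, 64); (75, 71);
     (67, 86); (5, 24); (35, 35); (20, 30); (21, 34); (10, 29); (17, 33);
     (25, 51); (38, 69); (42, 71); (35, 62); (24, 47); (18, 38); (29, 53);
     (38, 63); (30, 50); (24, 43); (22, 38); (35, 55); (38, 55); (36, 52);
     (31, 45); (27, 40); (34, 38); (34, 44); (28, 37); (58, 7); (37, 36);
     (48, 21); (48, 25); (56, 14); (51, 21); (51, 42); (47, 65); (44, 69);
     (47, 58); (51, 38); (53, 27); (48, 46); (45, 61); (46, 45); (49, 35);
     (49, 30); (44, 52); (41, 54); (42, 51); (44, 41); (45, 34); (39, 36);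
     (43, 41); (43, 32); (58, 5); (36, 34); (45, 21); (44, 20); (53, 9);
     (47, 14); (32, 14); (14, 20); (10, 24); (21, 20); (36, 14); (44, 13);
     (28, 18); (17, 23); (29, 21); (37, 17); (41, 18); (23, 24); (21, 28);
     (25, 27); (32, 24); (37, 22); (35, 31); (30, 28); (38, 25)]%stdZ.

(* The diagonals of the outer pentagon 2, 1, 4, 6, 5, bent outside of it, in  *)
(* the scale of [vertex_pos].                                                 *)
Definition bends : seq ((nat * nat) * (Z * Z)) :=
  [::
     ((1, 5)%N, (120, 0)%stdZ); ((2, 4)%N, (2, 41)%stdZ);
     ((1, 6)%N, (2, 167)%stdZ); ((4, 5)%N, (120, 208)%stdZ);
     ((2, 6)%N, (196, 104)%stdZ)].

(** Inner labels 3 to 27 of copy [j] become 25j + 4 to 25j + 28, so the copy is recovered as (x - 4)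
    / 25. *)
Definition glue (j x : nat) : nat :=
  if x < 3 then
    let corners :=
      [:: [:: 0; 1; 2]; [:: 0; 1; 3]; [:: 0; 2; 3]; [:: 1; 2; 3]] in
    nth 0 (nth [::] corners j) x
  else 25 * j + x.+1.

Definition faces : seq (seq nat) :=
  [seq map (glue j) f | j <- iota 0 4, f <- pentagons].

Fixpoint pairs (f : seq nat) : seq (nat * nat) :=
  if f is x :: f' then map (sort2 x) f' ++ pairs f' else [::].

Definition edge_list : seq (nat * nat) :=
  undup (flatten (map pairs faces)).

(* Doubled, so that midpoints are integral. *)
Definition vertex_pos (x : nat) : point :=
  let p := nth (0, 0)%stdZ coords x in (2 * p.1, 2 * p.2)%stdZ.

(** * Computed properties of the graph and conclusion *)

Lemma size_edge_list : size edge_list = 510.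
Proof. by lazy. Qed.

Lemma edge_list_uniq : uniq edge_list.
Proof. exact: undup_uniq. Qed.

Lemma edge_list_bounded : bounded 103 edge_list.
Proof. by lazy. Qed.

Lemma edge_list_lower_neighbours :
  all (fun v => minn 3 v <= count (fun e => e.2 == v) edge_list) (iota 0 104).
Proof. by lazy. Qed.

Lemma edge_list_fillings :
  all (fun e => (e.1 < 4) || ((e.1 - 4) %/ 25 == (e.2 - 4) %/ 25)) edge_list.
Proof. by lazy. Qed.

Lemma edge_list01 : (0, 1) \in edge_list.
Proof. by lazy. Qed.

Lemma vertex_pos_uniq : uniq (map vertex_pos (iota 0 104)).
Proof. by lazy. Qed.

Lemma edge_list_monotone : monotone_check edge_list vertex_pos bends.
Proof. by lazy. Qed.

Lemma edge_list_avoid : avoid_check 103 edge_list vertex_pos bends.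
Proof. by lazy. Qed.

Lemma edge_list_carried : carried_check edge_list vertex_pos bends.
Proof. by lazy. Qed.

Lemma edge_list_crossings : crossing_check edge_list vertex_pos bends 2.
Proof. by lazy. Qed.

Lemma card_ord_count (n : nat) (p : pred nat) :
  #|[set x : 'I_n | p x]%SET| = count p (iota 0 n).
Proof. by rewrite cardsE cardE size_filter -enumT -val_enum_ord count_map. Qed.

Lemma edge_list_not_1_extendable : ~ extendable 1 (list_graph 103 edge_list).
Proof.
set G := list_graph 103 edge_list.
have /allP fillings := edge_list_fillings.
have ord_lt (x y : G) : x < y -> adj x y ->
    (x < 4) || ((x - 4) %/ 25 == (y - 4) %/ 25).
  move=> xy; rewrite (list_adj_lt xy); exact: fillings.
pose S := [set x : 'I_104 | x < 4]%SET.
(* The condition [3 < x] is essential: truncated subtraction would otherwise put [S] into filling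
   0. *)
pose C (i : 'I_4) := [set x : 'I_104 | (3 < x) && ((x - 4) %/ 25 == i)]%SET.
have := list_edge_adj edge_list_bounded edge_list01.
have inord_lt k : k < 4 -> inord k \in S.
  by move=> k4; rewrite finset.in_set inordK // (leq_trans k4).
move=> /(@not_1_extendable G 'I_4 S C); apply; try exact: inord_lt.
- by rewrite card_ord (@card_ord_count 104 (fun x => x < 4)); lazy.
- move=> i.
  rewrite (@card_ord_count 104 (fun x => (3 < x) && ((x - 4) %/ 25 == i))).
  by case: i => -[|[|[|[|//]]]] i4; lazy.
- move=> i x y; rewrite !finset.in_set => /andP[x3 /eqP xi] xy.
  apply: contraR; rewrite -leqNgt => y3; rewrite y3 -xi /=.
  have [lt_xy|lt_yx|/ord_inj -> //] := ltngtP x y.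
    by have := ord_lt _ _ lt_xy xy; rewrite ltnNge x3 /= eq_sym.
  by move: xy; rewrite adj_sym => /(ord_lt _ _ lt_yx); rewrite ltnNge y3.
- move=> i j x; rewrite !finset.in_set => /andP[_ /eqP xi] /andP[_ /eqP xj].
  by apply: ord_inj; rewrite -xi -xj.
by move=> i x; rewrite !finset.in_set => /andP[x3 _]; rewrite -leqNgt.
Qed.

Theorem mainTheorem7 (R : realType) :
  exists G : sgraph,
    [/\ k_connected 3 G, optimal_2_planar R G, ~~ odd #|G|
      & ~ extendable 1 G].
Proof.
exists (list_graph 103 edge_list); split.
- exact: (list_graph_k_connected (k := 3) edge_list_bounded edge_list_uniq isT
    edge_list_lower_neighbours).
- split.
    exact: (list_graph_k_planar R edge_list_bounded vertex_pos_uniq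
      edge_list_monotone edge_list_avoid edge_list_carried edge_list_crossings).
  rewrite (card_list_edges edge_list_bounded edge_list_uniq) size_edge_list.
  by rewrite card_ord.
- by rewrite card_ord.
exact: edge_list_not_1_extendable.
Qed.
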